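(* Let $S$ be a Hilbert-style proof system for the implicational propositional language whose only inference rule is modus ponens and whose axioms include all instances of the schemes $A \supset (B \supset A)$ and $[A \supset (B \supset C)] \supset [(A \supset B) \supset (A \supset C)]$ (and possibly instances of further axiom schemes). Then every instance of the Peirce scheme $[(A \supset B) \supset A] \supset A$ is a theorem of $S$ if and only if every instance of the scheme $(A \supset Q) \supset \{ [ (A \supset B) \supset Q] \supset Q \}$ is a theorem of $S$ (where $A, B, Q$ range over all well-formed formulas).
   Context: The implicational propositional language has propositional variables and the single binary connective $\supset$ (the conditional); well-formed formulas are built from variables using $\supset$. A theorem of $S$ is a formula deducible in $S$ from no hypotheses; $\Gamma \vdash B$ means $B$ is deducible in $S$ from the set of hypotheses $\Gamma$ using the axioms of $S$ and modus ponens (from $A$ and $A \supset B$ infer $B$). *)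

(* Defs.v *)
From Stdlib Require Import Ensembles.

Inductive formula (V : Type) : Type :=
| Var : V -> formula V
| Imp : formula V -> formula V -> formula V.

Arguments Var {V} _.
Arguments Imp {V} _ _.

Declare Scope formula_scope.
Delimit Scope formula_scope with F.
Bind Scope formula_scope with formula.
Notation "A ⊃ B" := (Imp A B) (at level 55, right associativity) : formula_scope.

(* A Hilbert system with modus ponens as its only rule is determined by its set
   [Ax] of axioms, i.e. the set of all instances of all its axiom schemes;
   scheme metavariables are quantified over [formula V] at the meta level. *)
Inductive deducible {V : Type} (Ax Gamma : Ensemble (formula V)) :
  formula V -> Prop :=
| ded_axiom A : In _ Ax A -> deducible Ax Gamma A
| ded_hyp A : In _ Gamma A -> deducible Ax Gamma A
| ded_mp A B : deducible Ax Gamma A -> deducible Ax Gamma (A ⊃ B) ->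
    deducible Ax Gamma B.

Definition is_theorem {V : Type} (Ax : Ensemble (formula V)) (A : formula V) :
  Prop := deducible Ax (Empty_set _) A.

(* Main.v *)
(* Peirce's law for [Q] and [B] gives the second scheme: from [A ⊃ Q],
   [(A ⊃ B) ⊃ Q] and [Q ⊃ B] one gets [A ⊃ B] by transitivity, hence [Q], so
   [(Q ⊃ B) ⊃ Q] is deducible from the first two.  Conversely, Peirce's law is
   the case [Q = A] of the second scheme, detached from [A ⊃ A]. *)

Require Import Defs.
From Stdlib Require Import Ensembles.

Open Scope formula_scope.

Lemma deducible_weaken {V : Type} (Ax Gamma Delta : Ensemble (formula V))
  (A : formula V) :
  Included _ Gamma Delta -> deducible Ax Gamma A -> deducible Ax Delta A.
Proof.
  intros sub H.
  induction H as [A HA | A HA | A B _ IHA _ IHAB].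
  - now apply ded_axiom.
  - now apply ded_hyp, sub.
  - now apply ded_mp with A.
Qed.

Lemma deducible_hyp_add {V : Type} (Ax Gamma : Ensemble (formula V))
  (A : formula V) : deducible Ax (Add _ Gamma A) A.
Proof. apply ded_hyp; right; constructor. Qed.

Lemma deducible_weaken_add {V : Type} (Ax Gamma : Ensemble (formula V))
  (A B : formula V) :
  deducible Ax Gamma B -> deducible Ax (Add _ Gamma A) B.
Proof. apply deducible_weaken; now left. Qed.

(** The combinator identity [I = S K K]: instantiate [axiom_S] with [A], [A ⊃ A], [A] and detach two
    instances of [axiom_K]. *)
Lemma deducible_refl {V : Type} (Ax Gamma : Ensemble (formula V))
  (axiom_K : forall A B : formula V, In _ Ax (A ⊃ (B ⊃ A)))
  (axiom_S : forall A B C : formula V,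
     In _ Ax ((A ⊃ (B ⊃ C)) ⊃ ((A ⊃ B) ⊃ (A ⊃ C)))) (A : formula V) :
  deducible Ax Gamma (A ⊃ A).
Proof.
  apply ded_mp with (A ⊃ (A ⊃ A)); [now apply ded_axiom |].
  apply ded_mp with (A ⊃ ((A ⊃ A) ⊃ A)); now apply ded_axiom.
Qed.

(** Induction on the derivation of [B]: [axiom_K] prefixes [A] to any axiom, including those of
    further schemes, and to any member of [Gamma]; [A] itself needs [A ⊃ A]. As modus ponens is the
    only rule, [axiom_S] settles the remaining case. *)
Lemma deduction_theorem {V : Type} (Ax Gamma : Ensemble (formula V))
  (axiom_K : forall A B : formula V, In _ Ax (A ⊃ (B ⊃ A)))
  (axiom_S : forall A B C : formula V,
     In _ Ax ((A ⊃ (B ⊃ C)) ⊃ ((A ⊃ B) ⊃ (A ⊃ C)))) (A B : formula V) :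
  deducible Ax (Add _ Gamma A) B -> deducible Ax Gamma (A ⊃ B).
Proof.
  intros H.
  induction H as [B HB | B HB | B C _ IHB _ IHBC].
  - apply ded_mp with B; now apply ded_axiom.
  - destruct HB as [B HG | B []].
    + apply ded_mp with B; [now apply ded_hyp | now apply ded_axiom].
    + now apply deducible_refl.
  - apply ded_mp with (A ⊃ B); [exact IHB |].
    apply ded_mp with (A ⊃ (B ⊃ C)); [exact IHBC | now apply ded_axiom].
Qed.

Theorem theorem1 (V : Type) (Ax : Ensemble (formula V))
  (axiom_K : forall A B : formula V, In _ Ax (A ⊃ (B ⊃ A)))
  (axiom_S : forall A B C : formula V,
     In _ Ax ((A ⊃ (B ⊃ C)) ⊃ ((A ⊃ B) ⊃ (A ⊃ C)))) :
  (forall A B : formula V, is_theorem Ax (((A ⊃ B) ⊃ A) ⊃ A)) <->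
  (forall A B Q : formula V,
     is_theorem Ax ((A ⊃ Q) ⊃ (((A ⊃ B) ⊃ Q) ⊃ Q))).
Proof.
  split.
  - intros peirce A B Q.
    do 2 (apply deduction_theorem; [assumption.. |]).
    apply ded_mp with ((Q ⊃ B) ⊃ Q);
      [| now do 2 apply deducible_weaken_add; apply peirce].
    apply deduction_theorem; [assumption.. |].
    apply ded_mp with (A ⊃ B);
      [| apply deducible_weaken_add, deducible_hyp_add].
    apply deduction_theorem; [assumption.. |].
    (* The hypotheses are now, oldest first, [A ⊃ Q], [(A ⊃ B) ⊃ Q], [Q ⊃ B] and [A]. Each is
       reached by one weakening per hypothesis added after it. *)
    apply ded_mp with Q; [apply ded_mp with A |].
    + apply deducible_hyp_add.
    + do 3 apply deducible_weaken_add; apply deducible_hyp_add.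
    + apply deducible_weaken_add, deducible_hyp_add.
  - intros scheme A B.
    apply ded_mp with (A ⊃ A); [now apply deducible_refl | apply scheme].
Qed.
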